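(* Let $R$ be a discrete valuation ring and $E$ a Drinfeld module over $S=\mathrm{Spf}R$. Then $\mathbf X_0(E)=\mathrm{Hom}_A(E,\hat{\mathbb G}_a)=\{0\}$.
   Context: Let $q=p^h$, $A=\mathcal O(X\setminus\{\infty\})$ for a projective, geometrically connected, smooth curve $X$ over $\mathbb F_q$ and $\infty\in X(\mathbb F_q)$; $\mathfrak p\subset A$ a maximal ideal, $\hat A$ the $\mathfrak p$-adic completion, $\hat q=|A/\mathfrak p|$, $t\in\mathfrak p\setminus\mathfrak p^2$ with image $\pi\in\hat A$. $R$ is an $\hat A$-algebra which is $\pi$-adically complete and $\pi$-torsion free, with structure map $\theta:A\to R$ and an $\hat A$-algebra endomorphism $\phi$ with $\phi(x)\equiv x^{\hat q}\bmod\pi R$; $S=\mathrm{Spf}R$. $\hat{\mathbb G}_a=\mathrm{Spf}R\langle x\rangle$ with $A$-action $a\mapsto\theta(a)\tau^0$; $R\{\tau\}^\wedge$ = sums $\sum b_i\tau^i$, $b_i\in R$, $b_i\to0$ $\pi$-adically, acting by $x\mapsto\sum b_ix^{q^i}$, composition $b\tau^i\circ c\tau^j=bc^{q^i}\tau^{i+j}$. An admissible $A$-module scheme is $\hat{\mathbb G}_a$ with a ring map $\varphi_E:A\to R\{\tau\}^\wedge$ whose $\tau^0$-coefficient at $a$ is $\theta(a)$. A Drinfeld module of rank $r$ is an admissible $A$-module scheme such that for each nonzero $a\in A$, $\ker\varphi_E(a)$ is finite of degree $q^{-r\,\mathrm{ord}_\infty(a)}$ over $S$. $\mathrm{Hom}_A(E,\hat{\mathbb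 G}_a)$ is the set of $f\in R\{\tau\}^\wedge$ with $f\circ\varphi_E(a)=\theta(a)\tau^0\circ f$ for all $a$. *)

(* Defs.v *)
From HB Require Import structures.
From mathcomp Require Import all_boot all_order all_algebra.
From mathcomp Require Import boolp classical_sets.

Set Implicit Arguments.
Unset Strict Implicit.
Unset Printing Implicit Defensive.

Import Order.TTheory GRing.Theory Num.Theory.
Local Open Scope ring_scope.

(* A pointed curve (X, oo) over the finite field F is given by its function
   field: smooth projective geometrically connected curves over F correspond to
   function fields in one variable whose field of constants is exactly F (F is
   perfect), closed points to normalized discrete valuations trivial on F, and
   the local ring at a closed point to the valuation ring. *)

(* The value of v at 0 is irrelevant: it is never used below. *)
Record discrete_valuation (K : fieldType) (v : K -> int) : Prop := {
  valuationM : forall x y, x != 0 -> y != 0 -> v (x * y) = v x + v y;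
  valuationD : forall x y, x != 0 -> y != 0 -> x + y != 0 ->
    Num.min (v x) (v y) <= v (x + y);
  valuation_normalized : exists2 x, x != 0 & v x = 1 }.

Definition integral_at (K : fieldType) (v : K -> int) (x : K) : bool :=
  (x == 0) || (0 <= v x).

Definition vanishes_at (K : fieldType) (v : K -> int) (x : K) : bool :=
  (x == 0) || (0 < v x).

Definition discrete_valuation_ring (R : idomainType) : Prop :=
  exists v : {fraction R} -> int, discrete_valuation v /\
    forall x, integral_at v x <-> exists a : R, x = FracField.tofrac a.

Record function_field (F : finFieldType) (K : fieldType)
    (iota : {rmorphism F -> K}) : Prop := {
  finite_over_rational : exists2 x : K, ~ algebraicOver iota x &
    exists (n : nat) (e : 'I_n -> K), forall y, exists P Q : 'I_n -> {poly F},
      (forall i, Q i != 0) /\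
      y = \sum_(i < n)
            (map_poly iota (P i)).[x] / (map_poly iota (Q i)).[x] * e i;
  full_constants : forall y, algebraicOver iota y -> exists c, y = iota c }.

Definition place (F : finFieldType) (K : fieldType) (iota : {rmorphism F -> K})
    (v : K -> int) : Prop :=
  discrete_valuation v /\ forall c, c != 0 -> v (iota c) = 0.

Definition rational_place (F : finFieldType) (K : fieldType)
    (iota : {rmorphism F -> K}) (v : K -> int) : Prop :=
  place iota v /\
  forall x, integral_at v x -> exists c : F, vanishes_at v (x - iota c).

Section AffineRing.
Variables (F : finFieldType) (K : fieldType) (iota : {rmorphism F -> K}).
Variable ord_oo : K -> int.

Definition regular_away : {pred K} := fun x =>
  `[< forall v, place iota v -> (exists2 y, y != 0 & v y <> ord_oo y) ->
        integral_at v x >].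

Lemma valuation1 (v : K -> int) : discrete_valuation v -> v 1 = 0.
Proof.
move=> hv; have := valuationM hv (oner_neq0 K) (oner_neq0 K).
by rewrite mulr1 -{1}[v 1]addr0 => /addrI <-.
Qed.

Lemma valuationN1 (v : K -> int) : discrete_valuation v -> v (- 1) = 0.
Proof.
move=> hv; have n0 : - 1 != 0 :> K by rewrite oppr_eq0 oner_eq0.
have := valuationM hv n0 n0; rewrite mulrNN mulr1 (valuation1 hv).
by move/eqP; rewrite eq_sym -mulr2n mulrn_eq0 => /eqP.
Qed.

Lemma integral_atM (v : K -> int) x y : discrete_valuation v ->
  integral_at v x -> integral_at v y -> integral_at v (x * y).
Proof.
move=> hv; rewrite /integral_at mulf_eq0.
have [//|x0] := eqVneq x 0; have [//|y0] := eqVneq y 0 => /= vx vy.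
by rewrite (valuationM hv) // addr_ge0.
Qed.

Lemma integral_atB (v : K -> int) x y : discrete_valuation v ->
  integral_at v x -> integral_at v y -> integral_at v (x - y).
Proof.
move=> hv ix iy.
have : integral_at v (- y).
  rewrite -mulN1r; apply: integral_atM => //.
  by rewrite /integral_at (valuationN1 hv) lexx orbT.
move: ix {iy}; rewrite /integral_at.
have [->|x0] := eqVneq x 0; first by rewrite sub0r.
have [->|y0] := eqVneq (- y) 0; first by rewrite addr0 (negPf x0).
have [//|xy0] := eqVneq (x - y) 0 => /= vx vy.
by apply: le_trans (valuationD hv x0 y0 xy0); rewrite le_min vx vy.
Qed.

Fact regular_away_subring : subring_closed regular_away.
Proof.
split=> [|x y /asboolP hx /asboolP hy|x y /asboolP hx /asboolP hy];
  apply/asboolP => v hv hoo; have [dv _] := hv.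
- by rewrite /integral_at (valuation1 dv) lexx orbT.
- by apply: integral_atB; [|apply: hx|apply: hy].
- by apply: integral_atM; [|apply: hx|apply: hy].
Qed.

HB.instance Definition _ :=
  GRing.isSubringClosed.Build K regular_away regular_away_subring.

(* The ring O(X \ {oo}) of functions whose only poles are at oo. *)
Record affine_ring := AffineRing {
  function_of :> K;
  _ : function_of \in regular_away }.

HB.instance Definition _ := [isSub for function_of].
HB.instance Definition _ := [Choice of affine_ring by <:].
HB.instance Definition _ := [SubChoice_isSubComNzRing of affine_ring by <:].

End AffineRing.

(* idealr_closed includes properness *)
Definition maximal_ideal (A : comNzRingType) (I : {pred A}) : Prop :=
  idealr_closed I /\
  forall J : {pred A}, idealr_closed J -> {subset I <= J} -> {subset J <= I}.

Definition quotient_card (A : comNzRingType) (I : {pred A}) (n : nat) : Prop :=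
  exists s : 'I_n -> A, forall a, exists! i, a - s i \in I.

Definition ideal_mul (A : comNzRingType) (I J : {pred A}) : {pred A} := fun x =>
  `[< exists s : seq (A * A),
        {in s, forall u, u.1 \in I /\ u.2 \in J} /\
        x = \sum_(u <- s) u.1 * u.2 >].

Definition ideal_pow (A : comNzRingType) (I : {pred A}) (n : nat) : {pred A} :=
  iter n (ideal_mul I) predT.

(* c : A -> Ahat exhibits Ahat as the limit of the rings A / I^(n+1), n >= 0:
   J n is the kernel of the projection Ahat -> A / I^(n+1). *)
Definition adic_completion (A Ahat : comNzRingType) (I : {pred A})
    (c : {rmorphism A -> Ahat}) : Prop :=
  exists J : nat -> {pred Ahat},
    [/\ forall n, idealr_closed (J n) /\ {subset J n.+1 <= J n},
        forall n a, (c a \in J n) = (a \in ideal_pow I n.+1),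
        forall n x, exists a, x - c a \in J n
      & forall a : nat -> A, (forall n, a n.+1 - a n \in ideal_pow I n.+1) ->
          exists! x, forall n, x - c (a n) \in J n].

Definition divides (R : comNzRingType) (d x : R) : Prop :=
  exists y, x = d * y.

Definition adically_complete (R : comNzRingType) (pi : R) : Prop :=
  forall x : nat -> R, (forall n, divides (pi ^+ n) (x n.+1 - x n)) ->
    exists! l, forall n, divides (pi ^+ n) (l - x n).

Definition torsion_free (R : comNzRingType) (pi : R) : Prop :=
  forall x : R, pi * x = 0 -> x = 0.

(* The null sequences are the elements b of R<x> (as \sum_i b_i x^i) and of
   R{tau}^ (as \sum_i b_i tau^i). *)
Definition null_sequence (R : comNzRingType) (pi : R) (b : nat -> R) : Prop :=
  forall k, exists N, forall i, (N <= i)%N -> divides (pi ^+ k) (b i).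

Definition series_mul (R : comNzRingType) (b c : nat -> R) : nat -> R :=
  fun n => \sum_(i < n.+1) b i * c (n - i)%N.

Definition tau_mul (R : comNzRingType) (q : nat) (b c : nat -> R) : nat -> R :=
  fun n => \sum_(i < n.+1) b i * c (n - i)%N ^+ (q ^ i).

Definition tau_const (R : comNzRingType) (b : R) : nat -> R :=
  fun n => if n == 0%N then b else 0.

(* \sum_i b_i x^(q^i); the bound i <= n loses nothing since i < q^i. *)
Definition tau_series (R : comNzRingType) (q : nat) (b : nat -> R) : nat -> R :=
  fun n => \sum_(i < n.+1 | (q ^ i == n)%N) b i.

(* With M := R<x> / (P): the localization M_s is free over R_s, with basis the
   images of e_0, ..., e_(d-1) in R<x>. *)
Definition quotient_free_at (R : comNzRingType) (pi : R) (P : nat -> R)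
    (d : nat) (s : R) : Prop :=
  exists e : 'I_d -> nat -> R,
    [/\ forall i, null_sequence pi (e i),
        forall g, null_sequence pi g -> exists k (c : 'I_d -> R) h,
          null_sequence pi h /\
          forall j, s ^+ k * g j = \sum_(i < d) c i * e i j + series_mul P h j
      & forall c : 'I_d -> R,
          (exists k h, null_sequence pi h /\
             forall j, s ^+ k * (\sum_(i < d) c i * e i j) = series_mul P h j) ->
          forall i, exists k, s ^+ k * c i = 0].

(* Spf R<x>/(P) is finite (locally free) of degree d over Spf R. *)
Definition finite_of_degree (R : comNzRingType) (pi : R) (P : nat -> R)
    (d : nat) : Prop :=
  exists (m : nat) (s u : 'I_m -> R),
    \sum_(i < m) u i * s i = 1 /\ forall i, quotient_free_at pi P d (s i).

Section AModules.
Variables (A R : comNzRingType) (q : nat) (pi : R) (theta : {rmorphism A -> R}).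

(* The map phiE is a ring morphism from A to R{tau}^. *)
Record admissible_module (phiE : A -> nat -> R) : Prop := {
  admissible_null : forall a, null_sequence pi (phiE a);
  admissibleD : forall a b, phiE (a + b) = fun i => phiE a i + phiE b i;
  admissible1 : phiE 1 = tau_const 1;
  admissibleM : forall a b, phiE (a * b) = tau_mul q (phiE a) (phiE b);
  admissible_theta : forall a, phiE a 0%N = theta a }.

Definition drinfeld_module (ord : A -> int) (r : nat) (phiE : A -> nat -> R) :
    Prop :=
  admissible_module phiE /\
  forall a, a != 0 -> exists d : nat,
    d%:R = q%:R ^ (- (r%:Z * ord a)) :> rat /\
    finite_of_degree pi (tau_series q (phiE a)) d.

Definition Ga_action (a : A) : nat -> R := tau_const (theta a).

Definition Hom_A (phiE phiE' : A -> nat -> R) : set (nat -> R) :=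
  [set f | null_sequence pi f /\
           forall a, tau_mul q f (phiE a) = tau_mul q (phiE' a) f].

End AModules.

(* Main.v *)
(* A non-zero f has coefficients of least valuation n; let f_i be the first of
   them. If the reduction of phi_E(t) modulo the maximal ideal of R is non-zero,
   let j be the first index where its coefficient is a unit. Then the
   coefficient of tau^(i+j) in f o phi_E(t) has valuation n, whereas in theta(t) f
   every coefficient has valuation > n, because theta(t) is not a unit of the
   pi-adically complete ring R. The reduction of phi_E(t) is non-zero since
   otherwise the special fibre of the kernel of phi_E(t) would be the whole affine
   line, which is not finite. *)
Require Import Defs.
From mathcomp Require Import all_boot all_order all_algebra.
From mathcomp Require Import zify.
From mathcomp Require Import boolp classical_sets.
Set Implicit Arguments.
Unset Strict Implicit.
Unset Printing Implicit Defensive.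

Import Order.TTheory GRing.Theory Num.Theory.
Local Open Scope ring_scope.
Local Open Scope classical_set_scope.

Section Valuation.
Variables (R : idomainType) (v : {fraction R} -> int).
Hypothesis vP : discrete_valuation v.
Hypothesis v_integral :
  forall x, integral_at v x <-> exists a : R, x = FracField.tofrac a.

Definition valR (x : R) : int := v (FracField.tofrac x).

(** [v] is arbitrary at 0, so 0 is given infinite valuation by hand. As valuations on [R] are
    nonnegative, [~~ val_ge 1 x] says that [x] is a unit. *)
Definition val_ge (n : int) (x : R) : bool := (x == 0) || (n <= valR x).

Lemma val_geE n x : x != 0 -> val_ge n x = (n <= valR x).
Proof. by rewrite /val_ge => /negPf->. Qed.

Lemma val_ge0 x : val_ge 0 x.
Proof.
have : integral_at v (FracField.tofrac x) by apply/v_integral; exists x.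
by rewrite /integral_at /val_ge tofrac_eq0.
Qed.

Lemma val1 : valR 1 = 0.
Proof. by rewrite /valR tofrac1 (valuation1 vP). Qed.

Lemma valM x y : x != 0 -> y != 0 -> valR (x * y) = valR x + valR y.
Proof. by move=> x0 y0; rewrite /valR tofracM (valuationM vP) ?tofrac_eq0. Qed.

Lemma val_geD n x y : val_ge n x -> val_ge n y -> val_ge n (x + y).
Proof.
have [->|x0] := eqVneq x 0; first by rewrite add0r.
have [->|y0] := eqVneq y 0; first by rewrite addr0.
have [->|xy0] := eqVneq (x + y) 0; first by rewrite /val_ge eqxx.
rewrite !val_geE // => nx ny.
have := @valuationD _ _ vP (FracField.tofrac x) (FracField.tofrac y).
rewrite -tofracD !tofrac_eq0 => /(_ x0 y0 xy0); apply: le_trans.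
by rewrite le_min nx.
Qed.

Lemma val_geM m n x y : val_ge m x -> val_ge n y -> val_ge (m + n) (x * y).
Proof.
have [->|x0] := eqVneq x 0; first by rewrite mul0r /val_ge eqxx.
have [->|y0] := eqVneq y 0; first by rewrite mulr0 /val_ge eqxx.
by rewrite !val_geE ?mulf_neq0 // valM //; apply: lerD.
Qed.

Lemma val_geMl n x y : val_ge n x -> val_ge n (x * y).
Proof. by rewrite -{2}[n]addr0 => nx; apply: val_geM (val_ge0 y). Qed.

Lemma val_geMr n x y : val_ge n y -> val_ge n (x * y).
Proof. by rewrite mulrC; apply: val_geMl. Qed.

Lemma val_geN n x : val_ge n x -> val_ge n (- x).
Proof. by rewrite -mulN1r; apply: val_geMr. Qed.

Lemma val_geX n x k : (0 < k)%N -> val_ge n x -> val_ge n (x ^+ k).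
Proof. by case: k => // k _; rewrite exprS; apply: val_geMl. Qed.

Lemma val_ge_sum n (I : Type) (s : seq I) (Q : pred I) (E : I -> R) :
  (forall i, Q i -> val_ge n (E i)) -> val_ge n (\sum_(i <- s | Q i) E i).
Proof.
move=> nE; apply: (big_ind (val_ge n)) nE; first by rewrite /val_ge eqxx.
exact: val_geD.
Qed.

Lemma val_unit x : ~~ val_ge 1 x -> x != 0 /\ valR x = 0.
Proof.
rewrite /val_ge negb_or => /andP[x0]; split=> //; move: (val_ge0 x).
by rewrite val_geE //; lia.
Qed.

Lemma unit_valX x k : ~~ val_ge 1 x -> ~~ val_ge 1 (x ^+ k).
Proof.
move=> /val_unit[x0 vx0]; rewrite val_geE ?expf_neq0 //.
suff -> : valR (x ^+ k) = 0 by [].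
by elim: k => [|k IHk]; rewrite ?val1 // exprS valM ?expf_neq0 // vx0 IHk.
Qed.

Lemma val_ge_unitMr n x y : ~~ val_ge 1 y -> val_ge n (x * y) = val_ge n x.
Proof.
move=> /val_unit[y0 vy0].
have [->|x0] := eqVneq x 0; first by rewrite mul0r.
by rewrite !val_geE ?mulf_neq0 // valM // vy0 addr0.
Qed.

(** The inverse in the fraction field also has valuation 0, so it lies in the valuation ring [R]. *)
Lemma unit_val_inv x : ~~ val_ge 1 x -> exists y, x * y = 1.
Proof.
move=> /val_unit[x0 vx0]; set X := FracField.tofrac x.
have X0 : X != 0 by rewrite tofrac_eq0.
have : integral_at v X^-1.
  have := valuationM vP X0 (invr_neq0 X0).
  rewrite divff // (valuation1 vP) -[v X]/(valR x) vx0 add0r => vX'.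
  by rewrite /integral_at -vX' lexx orbT.
case/v_integral=> y yE; exists y; apply/eqP; rewrite -tofrac_eq.
by rewrite tofracM -yE divff // tofrac1.
Qed.

(** If [pi] were a unit, its powers would divide everything, so both 0 and 1 would be limits of the
    zero sequence, against uniqueness of limits. *)
Lemma complete_val_ge1 pi : adically_complete pi -> val_ge 1 pi.
Proof.
move=> pi_complete; apply: contraT => /unit_val_inv[y piy].
have div_all n x : divides (pi ^+ n) x.
  by exists (y ^+ n * x); rewrite mulrA -exprMn piy expr1n mul1r.
have [l [_ l_uniq]] := pi_complete (fun=> 0) (fun n => div_all n _).
have /eqP : 0 = 1 :> R.
  by rewrite -(l_uniq 0) ?(l_uniq 1) // => n; apply: div_all.
by rewrite eq_sym oner_eq0.
Qed.

Lemma divides_val_ge n d x : val_ge n d -> divides d x -> val_ge n x.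
Proof. by move=> nd [y ->]; apply: val_geMl. Qed.

(** Valuations of nonzero elements of [R] are natural numbers, so the least one is attained, and
    then at a first index. *)
Lemma first_min_val (f : nat -> R) i : f i != 0 ->
  exists i0, [/\ f i0 != 0, forall j, val_ge (valR (f i0)) (f j)
    & forall j, (j < i0)%N -> val_ge (valR (f i0) + 1) (f j)].
Proof.
move=> fi0; have valE j : f j != 0 -> valR (f j) = `|valR (f j)|%N.
  by move=> fj0; have := val_ge0 (f j); rewrite val_geE //; lia.
pose Q k := `[< exists2 j, f j != 0 & `|valR (f j)|%N = k >].
have exQ : exists k, Q k by exists `|valR (f i)|%N; apply/asboolP; exists i.
case: (ex_minnP exQ) => n /asboolP[i1 fi1 vi1] n_min.
have exI : exists j, (f j != 0) && (`|valR (f j)|%N == n).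
  by exists i1; rewrite fi1 vi1 eqxx.
case: (ex_minnP exI) => i0 /andP[f0 /eqP v0] i0_min; exists i0.
have ge_n j : f j != 0 -> (n <= `|valR (f j)|)%N.
  by move=> fj; apply: n_min; apply/asboolP; exists j.
split=> // j => [|ji0]; rewrite /val_ge; case: eqVneq => //= fj.
  by rewrite (valE _ fj) (valE _ f0) v0 lez_nat ge_n.
have v_neq : `|valR (f j)|%N != n.
  by apply: contraTneq ji0 => vj; rewrite -leqNgt i0_min // fj vj eqxx.
by move: (ge_n _ fj) (valE _ fj) (valE _ f0); lia.
Qed.

(** If [P] reduced to 0 over the residue field, finitely many polynomials, the reductions of the
    [e l], would span all polynomials; a monomial of large degree refutes this. *)
Lemma finite_degree_reduction (pi : R) (P : nat -> R) (d : nat) :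
  val_ge 1 pi -> finite_of_degree pi P d -> exists n, ~~ val_ge 1 (P n).
Proof.
move=> pi1 [m [s [u [us1 s_free]]]].
apply: contrapT => /forallNP P_lt1.
have P1 n : val_ge 1 (P n) by apply: contrapT => /negP/P_lt1.
(* [R] is local and the [s i] generate the unit ideal, so one of them is a unit. *)
have [i si] : exists i, ~~ val_ge 1 (s i).
  apply: contrapT => /forallNP s_lt1.
  have : val_ge 1 (\sum_(i < m) u i * s i).
    apply: val_ge_sum => i _; apply: val_geMr.
    by apply: contrapT => /negP/s_lt1.
  by rewrite us1 val_geE ?oner_eq0 // val1.
have [e [e_null e_span _]] := s_free i.
have /choice[N Nle] : forall l, exists N, forall j,
    (N <= j)%N -> val_ge 1 (e l j).
  move=> l; have [N Nl] := e_null l 1%N; exists N => j /Nl.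
  by apply: divides_val_ge; rewrite expr1.
pose M := (\max_l N l)%N.
(* The monomial of degree [M] is tested: its coefficient times [s i ^+ k] is a unit, while at [M]
   every [e l] and the multiple of [P] lie in the maximal ideal. *)
have [|k [c [h [_ /(_ M)]]]] := e_span (fun j => (j == M)%:R).
  move=> k; exists M.+1 => j Mj; exists 0; rewrite mulr0.
  by have /negPf-> : j != M by rewrite neq_ltn Mj orbT.
rewrite eqxx mulr1 => skE; have := unit_valX k si; rewrite skE.
suff -> : val_ge 1 (\sum_(l < d) c l * e l M + series_mul P h M) by [].
apply: val_geD; apply: val_ge_sum => l _.
  by apply/val_geMr/Nle/leq_bigmax.
exact: val_geMl.
Qed.

(** This returns from the power series in x that defines the kernel to the coefficients of the
    powers of tau. *)
Lemma tau_series_reduction (q : nat) (b : nat -> R) n :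
  ~~ val_ge 1 (tau_series q b n) -> exists i, ~~ val_ge 1 (b i).
Proof.
apply: contraPP => b1; apply/negP; rewrite negbK; apply: val_ge_sum => i _.
by apply: contra_notT b1 => bi; exists i.
Qed.

Lemma tau_mul_scalar_eq0 (q : nat) (pi : R) (f b : nat -> R) j :
  (0 < q)%N -> val_ge 1 pi -> ~~ val_ge 1 (b j) ->
  (forall n, tau_mul q f b n = pi * f n) -> forall i, f i = 0.
Proof.
move=> q0 pi1 bj fb i; apply/eqP/contraT => /first_min_val[i0 [f0 f_ge f_gt]].
have [j0 bj0 j0_min] := ex_minnP (ex_intro (fun j => ~~ val_ge 1 (b j)) j bj).
(* This term is isolated from coefficient [i0 + j0] of the hypothesis. Its second factor is a unit,
   so the bound contradicts its valuation being that of [f i0]. *)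
have : val_ge (valR (f i0) + 1) (f i0 * b j0 ^+ (q ^ i0)).
  have i0_lt : (i0 < (i0 + j0).+1)%N by rewrite ltnS leq_addr.
  have := fb (i0 + j0)%N; rewrite /tau_mul (bigD1 (Ordinal i0_lt)) //= addKn.
  move/(canRL (addrK _)) ->; apply: val_geD.
    by rewrite addrC; apply: val_geM.
  apply/val_geN/val_ge_sum => l; rewrite -val_eqE /= => l_neq.
  (* Before [i0] the factor [f l] gains valuation; after [i0] the index of [b] is below [j0], so
     that factor lies in the maximal ideal. *)
  have [l_lt|l_ge] := ltnP l i0; first exact/val_geMl/f_gt.
  apply: val_geM => //; apply: val_geX; first by rewrite expn_gt0 q0.
  apply: contraT => /j0_min; have := ltn_ord l; lia.
by rewrite val_ge_unitMr ?unit_valX // val_geE // gerDl.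
Qed.

End Valuation.

Lemma tau_mul_const (R : comNzRingType) (q : nat) (b : R) (f : nat -> R) n :
  (0 < q)%N -> tau_mul q (tau_const b) f n = b * f n.
Proof.
move=> q0; rewrite /tau_mul big_ord_recl /= subn0 expn0 expr1 big1 ?addr0 //.
by move=> i _; rewrite /tau_const /= mul0r.
Qed.

Theorem theorem8p1
  (F : finFieldType) (K : fieldType) (iota : {rmorphism F -> K})
  (hK : function_field iota)
  (ord_oo : K -> int) (hoo : rational_place iota ord_oo)
  (p : {pred affine_ring iota ord_oo}) (hp : maximal_ideal p)
  (qhat : nat) (hqhat : quotient_card p qhat)
  (Ahat : comNzRingType) (c : {rmorphism affine_ring iota ord_oo -> Ahat})
  (hc : adic_completion p c)
  (t : affine_ring iota ord_oo)
  (htp : t \in p) (htp2 : t \notin ideal_pow p 2)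
  (R : idomainType) (hR : discrete_valuation_ring R)
  (alg : {rmorphism Ahat -> R})
  (hcomplete : adically_complete (alg (c t)))
  (htorsion : torsion_free (alg (c t)))
  (phi : {rmorphism R -> R})
  (hphi_alg : forall x : Ahat, phi (alg x) = alg x)
  (hphi_frob : forall x : R, divides (alg (c t)) (phi x - x ^+ qhat))
  (r : nat) (phiE : affine_ring iota ord_oo -> nat -> R)
  (hE : drinfeld_module #|F| (alg (c t)) (alg \o c)
          (fun a => ord_oo (function_of a)) r phiE) :
  Hom_A #|F| (alg (c t)) phiE (Ga_action (alg \o c)) = [set (fun=> 0)].
Proof.
have [v [vP v_integral]] := hR; set pi := alg (c t) in hE *.
have pi1 : val_ge v 1 pi by apply: (complete_val_ge1 vP v_integral).
have q0 : (0 < #|F|)%N by apply/card_gt0P; exists 0.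
(* If [t] were 0, so would be its image, and torsion-freeness would give 1 = 0. Finiteness of the
   kernel is available only for nonzero elements. *)
have t0 : t != 0.
  apply/eqP => t_eq0; have /eqP := oner_neq0 R; apply.
  by apply: htorsion; rewrite t_eq0 !rmorph0 mul0r.
have [n nP] : exists n, ~~ val_ge v 1 (phiE t n).
  have [_ /(_ t t0)[d [_ t_finite]]] := hE.
  have [n] := finite_degree_reduction vP v_integral pi1 t_finite.
  exact: (tau_series_reduction vP).
apply/seteqP; split=> f /= => [[_ fE]|->].
  apply/funext; apply: (tau_mul_scalar_eq0 vP v_integral q0 pi1 nP).
  (* The commutation relation is taken at [t], where [Ga_action] multiplies by [pi]. *)
  by move=> m; rewrite fE tau_mul_const.
split=> [k|a]; first by exists 0%N => i _; exists 0; rewrite mulr0.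
apply/funext => m; rewrite tau_mul_const // mulr0.
by rewrite /tau_mul big1 // => i _; rewrite mul0r.
Qed.
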